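(* Let $\mathbf{r}=(r_1,\dots,r_n)$ be a sequence of integers with $1\le r_1\le r_2\le\cdots\le r_n\le n$ and $r_k\ge k$ for all $k$. Let $\sigma_0\in S_{\mathbf r}$, and let $(h_1,\dots,h_n)$ be the height sequence of the Dyck path $D(\mathbf r)$. Then \[ \sum_{\sigma\in S_{\mathbf r}} q^{\mathrm{sor}_{\mathbf r}(\sigma,\sigma_0)}\prod_{i\in \mathrm{Cyc}(\sigma\sigma_0^{-1})}t_i=\prod_{i=1}^n\left(t_i+q+\cdots+q^{h_i-1}\right). \] In particular, \[ \sum_{\sigma\in S_{\mathbf r}} q^{\mathrm{sor}(\sigma)}\prod_{i\in \mathrm{Cyc}(\sigma)}t_i=\prod_{k=1}^n\left(t_k+q+\cdots+q^{h_k-1}\right) \] and \[ \sum_{\sigma\in S_{\mathbf r}} q^{\mathrm{sor}(\sigma)}t^{\mathrm{cyc}(\sigma)}=\sum_{\sigma\in S_{\mathbf r}} q^{\mathrm{inv}(\sigma)}t^{\mathrm{rlminl}(\sigma)}. \]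
   Context: Here $q,t,t_1,\dots,t_n$ are indeterminates, and $q+\cdots+q^{m}$ denotes $\sum_{j=1}^{m}q^j$ (which is $0$ if $m=0$). Permutations are composed as functions, $(\sigma\tau)(i)=\sigma(\tau(i))$. **Permutation statistics.** $S_{\mathbf r}=\{\sigma\in S_n:\sigma(k)\le r_k,\ 1\le k\le n\}$. $\mathrm{inv}(\sigma)$ is the number of pairs $i<j$ with $\sigma(i)>\sigma(j)$. $\mathrm{Rlminl}(\sigma)$ is the set of values $\sigma(i)$ with $\sigma(i)<\sigma(j)$ for all $j>i$, and $\mathrm{rlminl}(\sigma)=|\mathrm{Rlminl}(\sigma)|$. $\mathrm{Cyc}(\sigma)$ is the set of minimal elements of the cycles of $\sigma$ (fixed points included as cycles), and $\mathrm{cyc}(\sigma)=|\mathrm{Cyc}(\sigma)|$. Every $\sigma\in S_n$ has a unique expression $\sigma=(i_1\,j_1)(i_2\,j_2)\cdots(i_k\,j_k)$ as a product of transpositions with $i_s<j_s$ for all $s$ and $j_1<\cdots<j_k$; the sorting index is $\mathrm{sor}(\sigma)=\sum_{s=1}^k(j_s-i_s)$. **Dyck paths and matchings.** A Dyck path of semilength $n$ is a lattice path from $(0,0)$ to $(2n,0)$ with steps $(1,1)$ (rises) and $(1,-1)$ (falls) never going below the $x$-axis. The height of a rise is the $y$-coordinate of its right endpoint; the height sequence $(h_1,\dots,h_n)$ lists the heights of the rises from left to right. $D(\mathbf r)$ is the unique Dyck path of semilength $n$ whose $k$-th fall is preceded by exactly $r_k$ rises, for every $k$. A (perfect) matching on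 $\{1,\dots,2n\}$ is a partition into $n$ two-element blocks (arcs); an arc $i\cdot j$ with $i<j$ has opener $i$ and closer $j$; $M(v)$ denotes the vertex in the same block as $v$. $M$ has type $D$ if, for each $v$, $v$ is an opener of $M$ iff the $v$-th step of $D$ is a rise; $\mathcal M_n(D)$ is the set of matchings of type $D$. Openers are listed as $o_1<\cdots<o_n$ and closers as $c_1<\cdots<c_n$ (they depend only on $D$). **Sorting index of matchings.** For $M,M_0\in\mathcal M_n(D)$ define $M_n,\dots,M_1$ by $M_n=M$ and: if $M_k(o_k)=M_0(o_k)$ then $M_{k-1}=M_k$; otherwise $M_{k-1}$ is obtained from $M_k$ by replacing the arcs $o_k\cdot M_k(o_k)$ and $M_k(M_0(o_k))\cdot M_0(o_k)$ by $o_k\cdot M_0(o_k)$ and $M_k(M_0(o_k))\cdot M_k(o_k)$. Let \[\mathrm{sor}_k(M,M_0)=\begin{cases}|\{c: c>o_k,\ c\in[M_k(o_k),M_0(o_k)],\ M_0(c)<o_k\}|,& M_k(o_k)\le M_0(o_k),\\ |\{c: c>o_k,\ c\notin(M_0(o_k),M_k(o_k)),\ M_0(c)<o_k\}|,& M_0(o_k)<M_k(o_k),\end{cases}\] and $\mathrm{sor}(M,M_0)=\sum_{k=1}^n\mathrm{sor}_k(M,M_0)$. **The statistic $\mathrm{sor}_{\mathbf r}$.** Let $f_{\mathbf r}:S_{\mathbf r}\to\mathcal M_n(D(\mathbf r))$ be the bijection sending $\sigma$ to the matching with arcs $o_{\sigma(k)}\cdot c_k$, $1\le k\le n$. For $\sigma,\sigma_0\in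 S_{\mathbf r}$, $\mathrm{sor}_{\mathbf r}(\sigma,\sigma_0)=\mathrm{sor}(f_{\mathbf r}(\sigma),f_{\mathbf r}(\sigma_0))$. *)

(* Defs.v *)
From HB Require Import structures.
From mathcomp Require Import all_boot all_order all_fingroup all_algebra.
From mathcomp Require Import mpoly zify.

Set Implicit Arguments.
Unset Strict Implicit.
Unset Printing Implicit Defensive.

(* Everything is 0-indexed: 'I_n = {0, .., n-1} stands for {1, .., n} and      *)
(* 'I_n.*2 for {1, .., 2n}. Values and positions are shifted by one, but the   *)
(* entries r k are not, so sigma(k) <= r_k reads s k < r k.                    *)

Section Permutations.
Variable n : nat.
Implicit Types (s : 'S_n) (w : seq ('I_n * 'I_n)).

Definition Sr (r : 'I_n -> nat) : {set 'S_n} :=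
  [set s : 'S_n | [forall k, s k < r k]].

(* MathComp's product of permutations applies the left factor first. *)
Definition perm_comp s1 s2 : 'S_n := (s2 * s1)%g.

Definition invs s : nat :=
  #|[set p : 'I_n * 'I_n | (p.1 < p.2) && (s p.2 < s p.1)]|.

Definition Rlminl s : {set 'I_n} :=
  [set s i | i : 'I_n & [forall j : 'I_n, (i < j) ==> (s i < s j)]].

Definition rlminl s : nat := #|Rlminl s|.

Definition Cyc s : {set 'I_n} :=
  [set i | [exists C in porbits s, (i \in C) && [forall j in C, i <= j]]].

Definition cyc s : nat := #|Cyc s|.

Definition sort_factorization s w : bool :=
  [&& all (fun p : 'I_n * 'I_n => p.1 < p.2) w,
      sorted ltn [seq nat_of_ord p.2 | p <- w]
    & \big[perm_comp/1%g]_(p <- w) tperm p.1 p.2 == s].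

(* The length bound n only serves to make the search finite: increasing j's in *)
(* 'I_n leave room for at most n factors; see sorP below.                      *)
Definition sor s : nat :=
  if [pick w : n.-bseq ('I_n * 'I_n) | sort_factorization s w] is Some w
  then \sum_(p <- w) (p.2 - p.1) else 0.

End Permutations.

Section DyckPaths.
Variable n : nat.
Implicit Types (D : (n.*2).-tuple bool) (r : 'I_n -> nat).

(* Steps are booleans: true is a rise, false is a fall. *)
Definition rises D (m : nat) : nat := count id (take m D).
Definition falls D (m : nat) : nat := count negb (take m D).

Definition dyck_path D : bool :=
  [forall m : 'I_n.*2.+1, falls D m <= rises D m]
    && (rises D n.*2 == falls D n.*2).

(* The default value of nth is irrelevant: a Dyck path of semilength n has     *)
(* exactly n rises and n falls.                                                *)
Definition dflt_vertex (i : 'I_n) : 'I_n.*2 :=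
  widen_ord (leq_trans (leq_addr n n) (eq_leq (addnn n))) i.

Definition opener D (i : 'I_n) : 'I_n.*2 :=
  nth (dflt_vertex i) [seq v <- enum 'I_n.*2 | tnth D v] i.

Definition closer D (i : 'I_n) : 'I_n.*2 :=
  nth (dflt_vertex i) [seq v <- enum 'I_n.*2 | ~~ tnth D v] i.

(* The rise at vertex v ends at abscissa v.+1; on a Dyck path the subtraction  *)
(* is never truncated.                                                         *)
Definition height D (i : 'I_n) : nat :=
  rises D (opener D i).+1 - falls D (opener D i).+1.

Definition dyck_for r D : bool :=
  dyck_path D && [forall k, rises D (closer D k) == r k].

(* For admissible r exactly one path satisfies dyck_for r; see dyck_ofP.       *)
Definition dyck_of r : (n.*2).-tuple bool :=
  odflt (nseq_tuple n.*2 true) [pick D | dyck_for r D].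

End DyckPaths.

Section Matchings.
Variable n : nat.
Local Notation vertex := ('I_n.*2).
Implicit Types (D : (n.*2).-tuple bool) (M : {set {set vertex}}) (s : 'S_n).

Definition matching M : bool :=
  partition M [set: vertex] && [forall B in M, #|B| == 2].

Definition partner M (v : vertex) : vertex :=
  odflt v [pick w | (w != v) && ([set v; w] \in M)].

Definition is_opener M (v : vertex) : bool := v < partner M v.

Definition matchings_of_type D : {set {set {set vertex}}} :=
  [set M | matching M && [forall v, is_opener M v == tnth D v]].

Section Sorting.
Variables (D : (n.*2).-tuple bool) (M0 : {set {set vertex}}).

Definition sort_step M (k : 'I_n) : {set {set vertex}} :=
  let ok := opener D k in
  let b := partner M0 ok in
  if partner M ok == b then M else
  (M :\: [set [set ok; partner M ok]; [set partner M b; b]])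
    :|: [set [set ok; b]; [set partner M b; partner M ok]].

(* The matching M_k: the steps for o_n, ..., o_(k+1) have been performed.      *)
Definition sort_stage M (k : 'I_n) : {set {set vertex}} :=
  foldl sort_step M [seq i : 'I_n <- rev (enum 'I_n) | k < i].

Definition sor_at M (k : 'I_n) : nat :=
  let ok := opener D k in
  let a := partner (sort_stage M k) ok in
  let b := partner M0 ok in
  if a <= b
  then #|[set c : vertex | [&& ok < c, a <= c <= b & partner M0 c < ok]]|
  else #|[set c : vertex | [&& ok < c, ~~ (b < c < a) & partner M0 c < ok]]|.

End Sorting.

Definition sorM D M M0 : nat := \sum_(k < n) sor_at D M0 M k.

Definition fr (r : 'I_n -> nat) s : {set {set vertex}} :=
  let D := dyck_of r in [set [set opener D (s k); closer D k] | k : 'I_n].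

Definition sor_r (r : 'I_n -> nat) s s0 : nat :=
  sorM (dyck_of r) (fr r s) (fr r s0).

End Matchings.

(* The polynomial ring Z[q, t, t_1, .., t_n]. *)
Section Indeterminates.
Variable n : nat.
Definition var_q : {mpoly int[n.+2]} := 'X_ord0.
Definition var_t : {mpoly int[n.+2]} := 'X_(lift ord0 ord0).
Definition var_ti (i : 'I_n) : {mpoly int[n.+2]} := 'X_(lift ord0 (lift ord0 i)).
End Indeterminates.

(* Sanity of the definitions: sort factorizations and D(r) exist and are      *)
(* unique, and f_r(s) is a matching of type D(r) whose arcs are as expected.   *)

Section SortFactorizations.
Variable n : nat.
Implicit Types (s : 'S_n) (w : seq ('I_n * 'I_n)).
Lemma perm_compA : associative (@perm_comp n).
Proof. by move=> a b c; rewrite /perm_comp mulgA. Qed.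
Lemma perm_comp1 : left_id 1%g (@perm_comp n).
Proof. by move=> a; rewrite /perm_comp mulg1. Qed.
Lemma perm_compr1 : right_id 1%g (@perm_comp n).
Proof. by move=> a; rewrite /perm_comp mul1g. Qed.
HB.instance Definition _ := Monoid.isLaw.Build 'S_n 1%g (@perm_comp n) perm_compA perm_comp1 perm_compr1.

Lemma factorization_rcons s w p :
  sort_factorization s (rcons w p) =
  [&& p.1 < p.2, all (fun u : 'I_n * 'I_n => u.2 < p.2) w
    & sort_factorization (perm_comp s (tperm p.1 p.2)) w].
Proof.
rewrite /sort_factorization all_rcons map_rcons -!cats1 big_cat big_seq1 /=.
rewrite (sorted_pairwise ltn_trans) pairwise_cat /= -(sorted_pairwise ltn_trans).
rewrite allrel1r all_map.
have -> : (perm_comp (\big[@perm_comp n/1%g]_(q <- w) tperm q.1 q.2) (tperm p.1 p.2) == s)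
   = (\big[@perm_comp n/1%g]_(q <- w) tperm q.1 q.2 == perm_comp s (tperm p.1 p.2)).
  rewrite /perm_comp; apply/eqP/eqP => [<-|->]; rewrite mulgA tperm2 mul1g //.
case: (p.1 < p.2) => //=; rewrite ?andbT; set a := all _ w; set b := all _ w; set c := sorted _ _; set d := _ == _.
by case: a; case: b; case: c; case: d.
Qed.

Lemma factorization_id s w (j : 'I_n) :
  sort_factorization s w -> all (fun u : 'I_n * 'I_n => u.2 < j) w -> s j = j.
Proof.
elim/last_ind: w s => [|w p IH] s.
  by rewrite /sort_factorization /= big_nil => /eqP <-; rewrite perm1.
rewrite factorization_rcons all_rcons => /and3P[p12 _ H] /andP[pj Hw].
have := IH _ H Hw; rewrite /perm_comp permM tpermD //.
- by apply: contraTneq (ltn_trans p12 pj) => ->; rewrite ltnn.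
- by apply: contraTneq pj => ->; rewrite ltnn.
Qed.

Lemma factorization_uniq s w w' :
  sort_factorization s w -> sort_factorization s w' -> w = w'.
Proof.
have top (t : 'S_n) v p : sort_factorization t (rcons v p) ->
    t p.1 = p.2 /\ forall j : 'I_n, p.2 < j -> t j = j.
  rewrite factorization_rcons => /and3P[p12 Hv H]; split=> [|j pj].
    by have := factorization_id H Hv; rewrite /perm_comp permM tpermR.
  have Hj : all (fun u : 'I_n * 'I_n => u.2 < j) v.
    by apply: sub_all Hv => u Hu; apply: ltn_trans pj.
  have := factorization_id H Hj; rewrite /perm_comp permM tpermD //.
  - by apply: contraTneq (ltn_trans p12 pj) => ->; rewrite ltnn.
  - by apply: contraTneq pj => ->; rewrite ltnn.
have top2 (t : 'S_n) v p : sort_factorization t (rcons v p) -> t p.2 != p.2.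
  move=> H; have [H1 _] := top _ _ _ H; rewrite -{2}H1 (inj_eq perm_inj).
  by move: H; rewrite factorization_rcons => /andP[+ _]; rewrite -(inj_eq val_inj) /=; case: ltngtP.
elim/last_ind: w w' s => [|w p IH] w' s; elim/last_ind: w' => [|w' p' _] // H H'.
- have := top2 _ _ _ H'; case/and3P: H => _ _ /eqP <-.
  by rewrite big_nil perm1 eqxx.
- have := top2 _ _ _ H; case/and3P: H' => _ _ /eqP <-.
  by rewrite big_nil perm1 eqxx.
have [a b] := top _ _ _ H; have [a' b'] := top _ _ _ H'.
have e2 : p.2 = p'.2.
  apply: val_inj; case: (ltngtP p.2 p'.2) => // l.
  - by have := top2 _ _ _ H'; rewrite b ?eqxx.
  - by have := top2 _ _ _ H; rewrite b' ?eqxx.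
have e : p = p'.
  have e1 : p.1 = p'.1 by apply: (@perm_inj _ s); rewrite a a'.
  by case: p p' e1 e2 {a b a' b' H H'} => ? ? [? ?] /= -> ->.
rewrite -e in H' *; congr rcons.
move: H H'; rewrite !factorization_rcons => /and3P[_ _ H] /and3P[_ _ H'].
exact: IH H H'.
Qed.

Lemma factorization_ex s : exists w : n.-bseq ('I_n * 'I_n), sort_factorization s w.
Proof.
suff H m : m <= n -> (forall j : 'I_n, m <= j -> s j = j) ->
  exists w : seq ('I_n * 'I_n), [/\ sort_factorization s w, size w <= m & all (fun u : 'I_n * 'I_n => u.2 < m) w].
  have H0 (j : 'I_n) : n <= j -> s j = j by rewrite leqNgt ltn_ord.
  have [w [Hw sw _]] := H n (leqnn n) H0.
  by exists (Bseq sw).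
elim: m s => [|m IH] s mn Hs.
  exists [::]; split=> //; rewrite /sort_factorization big_nil /=; apply/eqP/permP => j.
  by rewrite perm1 Hs.
pose j := Ordinal mn.
have [sj|sj] := eqVneq (s j) j.
  have [k mk|w [Hw sw aw]] := IH s (ltnW mn).
    by case: (ltngtP m k) mk => // [mk|mk] _; [exact: Hs | have -> : k = j by exact: val_inj].
  exists w; split=> //; first by rewrite leqW.
  by apply: sub_all aw => u Hu; rewrite leqW.
pose i := (s^-1)%g j.
have si : s i = j by rewrite /i permKV.
have ij : i < j.
  case: (ltngtP i j) => // [l|e]; last by case/eqP: sj; rewrite -{2}si; congr (s _); exact: val_inj.
  by move: (Hs _ l); rewrite si => e; rewrite e ltnn in l.
have [k mk|w [Hw sw aw]] := IH (perm_comp s (tperm i j)) (ltnW mn).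
  rewrite /perm_comp permM; case: (ltngtP m k) mk => // [mk|mk] _.
    rewrite tpermD ?Hs //.
    - by apply: contraTneq (ltn_trans ij mk) => ->; rewrite ltnn.
    - by apply: contraTneq mk => <-; rewrite ltnn.
  by have -> : k = j; [exact: val_inj | rewrite tpermR].
exists (rcons w (i, j)); split; rewrite ?size_rcons ?factorization_rcons ?all_rcons /= ?ltnSn //.
- by rewrite ij aw.
- by apply: sub_all aw => u Hu; rewrite leqW.
Qed.

Lemma sorP s w : sort_factorization s w -> sor s = \sum_(p <- w) (p.2 - p.1).
Proof.
rewrite /sor => Hw; case: pickP => [w' Hw'|H]; first by rewrite (factorization_uniq Hw Hw').
by have [w' Hw'] := factorization_ex s; rewrite H in Hw'.
Qed.
End SortFactorizations.

Lemma enum_ord_sorted N : sorted <%O (enum 'I_N).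
Proof. by have := iota_ltn_sorted 0 N; rewrite -val_enum_ord sorted_map. Qed.

Lemma take_enum_ord N m : take m (enum 'I_N) = [seq v : 'I_N <- enum 'I_N | v < m].
Proof.
apply: (inj_map val_inj); rewrite map_take val_enum_ord -(filter_map val (fun i => i < m)) val_enum_ord.
rewrite take_iota; case: (leqP m N) => mN.
  by rewrite (@filter_iota_ltn 0 N m) ?subn0 //.
symmetry; apply/all_filterP/allP => i.
by rewrite mem_iota => /andP[_ iN]; apply: ltn_trans mN.
Qed.

Lemma card_ord_lt N m : #|[pred v : 'I_N | v < m]| = minn m N.
Proof.
rewrite cardE; have := congr1 size (take_enum_ord N m); rewrite size_take_min size_enum_ord => ->.
by rewrite enumT; congr size; rewrite [LHS]/enum_mem; apply: eq_filter => v; rewrite !inE.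
Qed.

Section DyckFor.
Variable n : nat.
Implicit Types (D : (n.*2).-tuple bool) (r : 'I_n -> nat).

Lemma fallsE D m : falls D m = count (fun v : 'I_n.*2 => v < m) [seq v <- enum 'I_n.*2 | ~~ tnth D v].
Proof.
rewrite /falls -[X in take m X](map_tnth_enum D) -map_take count_map take_enum_ord.
by rewrite !count_filter; apply: eq_count => v; rewrite /= [X in X && _]andbC.
Qed.
Lemma risesE D m : rises D m = count (fun v : 'I_n.*2 => v < m) [seq v <- enum 'I_n.*2 | tnth D v].
Proof.
rewrite /rises -[X in take m X](map_tnth_enum D) -map_take count_map take_enum_ord.
by rewrite !count_filter; apply: eq_count => v; rewrite /= [X in X && _]andbC.
Qed.
Lemma rises_falls D m : m <= n.*2 -> rises D m + falls D m = m.
Proof.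
by move=> mn; rewrite /rises /falls count_predC size_take_min size_tuple; apply/minn_idPl.
Qed.

Lemma nth_falls D x0 k : let f := [seq v <- enum 'I_n.*2 | ~~ tnth D v] in
  k < size f -> falls D (nth x0 f k) = k.
Proof.
move=> f kf; rewrite fallsE -/f; apply: (@Order.PreorderTheory.count_lt_nth _ 'I_n.*2) => //.
by apply: sorted_filter (enum_ord_sorted _); exact: Order.POrderTheory.lt_trans.
Qed.

Lemma dyck_size_falls D : dyck_path D -> size [seq v <- enum 'I_n.*2 | ~~ tnth D v] = n.
Proof.
case/andP=> _ /eqP e; have := rises_falls D (leqnn _).
rewrite e fallsE addnn => /double_inj; move=> E; rewrite -[RHS]E -[LHS]count_predT; apply: eq_count => v.
by rewrite /= ltn_ord.
Qed.

Definition dyck_explicit r : (n.*2).-tuple bool :=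
  [tuple [forall k : 'I_n, val v != r k + k] | v < n.*2].

Lemma dyck_for_unique r D : dyck_for r D -> D = dyck_explicit r.
Proof.
case/andP=> dD /forallP hr; set f := [seq v <- enum 'I_n.*2 | ~~ tnth D v].
have sf : size f = n by apply: dyck_size_falls.
have cE (k : 'I_n) : closer D k = r k + k :> nat.
  have := rises_falls D (ltnW (ltn_ord (closer D k))).
  by rewrite (eqP (hr k)) {1}/closer nth_falls // sf.
apply: eq_from_tnth => v; rewrite tnth_mktuple.
apply/idP/forallP => [Dv k|H].
  apply/eqP => e; have : closer D k \in f by apply: mem_nth; rewrite sf.
  by rewrite mem_filter (_ : closer D k = v) ?Dv //; apply: val_inj; rewrite /= cE.
apply/negPn/negP => Dv; have vf : v \in f by rewrite mem_filter Dv mem_enum.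
have iv : index v f < n by rewrite -{2}sf index_mem.
have := H (Ordinal iv); rewrite -cE /closer /= nth_index //.
by rewrite eqxx.
Qed.

Section Existence.
Variable r : 'I_n -> nat.
Hypothesis r_le : forall k, r k <= n.
Hypothesis r_mono : forall i j : 'I_n, i <= j -> r i <= r j.
Hypothesis r_ge : forall k : 'I_n, k < r k.

Let cP (k : 'I_n) : r k + k < n.*2.
Proof. by have := r_le k; have := ltn_ord k; lia. Qed.
Let c k := Ordinal (cP k).

Lemma falls_explicit : [seq v <- enum 'I_n.*2 | ~~ tnth (dyck_explicit r) v] = map c (enum 'I_n).
Proof.
have lt_tr := @Order.POrderTheory.lt_trans _ 'I_n.*2.
apply: (irr_sorted_eq lt_tr).
- by move=> x; rewrite Order.OrdinalOrder.Exports.ltEord /= ltnn.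
- exact: sorted_filter (enum_ord_sorted _).
- apply: (homo_sorted (e := <%O)) (enum_ord_sorted _) => i j.
  by rewrite !Order.OrdinalOrder.Exports.ltEord /= => ij; have := r_mono (ltnW ij); lia.
move=> v; rewrite mem_filter mem_enum andbT tnth_mktuple.
apply/idP/mapP => [|[k _ ->]]; rewrite negb_forall.
  by case/existsP => k; rewrite negbK => /eqP e; exists k; rewrite ?mem_enum //; apply: val_inj.
by apply/existsP; exists k; rewrite negbK.
Qed.

Lemma closer_explicit k : closer (dyck_explicit r) k = c k.
Proof. by rewrite /closer falls_explicit (nth_map k) ?size_enum_ord // nth_ord_enum. Qed.

Lemma dyck_for_explicit : dyck_for r (dyck_explicit r).
Proof.
have fE m : falls (dyck_explicit r) m = #|[pred k : 'I_n | r k + k < m]|.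
  rewrite fallsE falls_explicit count_map cardE -size_filter; congr size.
  by rewrite /enum_mem -filter_predI -enumT; apply: eq_filter => k; rewrite /= inE ?andbT.
apply/andP; split; first (apply/andP; split).
- apply/forallP => m; have := rises_falls (dyck_explicit r) (leq_ord m).
  suff : falls (dyck_explicit r) m <= m./2 by lia.
  rewrite fE; have -> : m./2 = minn m./2 n by have := ltn_ord m; lia.
  rewrite -card_ord_lt; apply: subset_leq_card; apply/subsetP => k; rewrite !inE.
  by have := r_ge k; lia.
- have := rises_falls (dyck_explicit r) (leqnn _); rewrite fE.
  have -> : #|[pred k : 'I_n | r k + k < n.*2]| = n.
    by rewrite -[RHS]card_ord; apply: eq_card => k; rewrite !inE cP.
  by lia.
apply/forallP => k; rewrite closer_explicit.
have := rises_falls (dyck_explicit r) (ltnW (cP k)); rewrite fE /=.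
suff -> : #|[pred k' : 'I_n | r k' + k' < r k + k]| = k by move/addIn->.
rewrite -[RHS](minn_idPl (ltnW (ltn_ord k))) -card_ord_lt; apply: eq_card => j; rewrite !inE.
case: (leqP k j) => kj; first by have := r_mono kj; lia.
by have := r_mono (ltnW kj); lia.
Qed.

Lemma dyck_ofP D : dyck_for r D = (D == dyck_of r).
Proof.
rewrite /dyck_of; case: pickP => [D' /dyck_for_unique ->|/(_ (dyck_explicit r))]; last by rewrite dyck_for_explicit.
by apply/idP/eqP => [/dyck_for_unique|->]; rewrite ?dyck_for_explicit.
Qed.
End Existence.

Lemma dyck_size_rises D : dyck_path D -> size [seq v <- enum 'I_n.*2 | tnth D v] = n.
Proof.
move=> dD; have := etrans (count_predC (tnth D) (enum 'I_n.*2)) (size_enum_ord _).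
have := dyck_size_falls dD; rewrite !size_filter => h.
by rewrite [X in _ + X]h -[X in _ = X -> _]addnn => /addIn.
Qed.

Section Matching.
Variables (r : 'I_n -> nat) (s : 'S_n).
Hypothesis r_le : forall k, r k <= n.
Hypothesis r_mono : forall i j : 'I_n, i <= j -> r i <= r j.
Hypothesis r_ge : forall k : 'I_n, k < r k.
Hypothesis sr : s \in Sr r.
Let D := dyck_of r.
Local Notation o := (opener D).
Local Notation c := (closer D).

Let dF : dyck_for r D. Proof. by rewrite dyck_ofP. Qed.
Let sro := dyck_size_rises (proj1 (andP dF)).
Let sfa := dyck_size_falls (proj1 (andP dF)).

Let oT i : tnth D (o i).
Proof.
have : o i \in [seq v <- enum 'I_n.*2 | tnth D v] by rewrite mem_nth ?sro.
by rewrite mem_filter => /andP[].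
Qed.
Let cF i : ~~ tnth D (c i).
Proof.
have : c i \in [seq v <- enum 'I_n.*2 | ~~ tnth D v] by rewrite mem_nth ?sfa.
by rewrite mem_filter => /andP[].
Qed.
Let o_inj : injective o.
Proof.
move=> i j; rewrite /opener (set_nth_default (dflt_vertex j)) ?sro // => /eqP.
by rewrite nth_uniq ?sro ?(filter_uniq _ (enum_uniq _)) // => /eqP /val_inj.
Qed.
Let c_inj : injective c.
Proof.
move=> i j; rewrite /closer (set_nth_default (dflt_vertex j)) ?sfa // => /eqP.
by rewrite nth_uniq ?sfa ?(filter_uniq _ (enum_uniq _)) // => /eqP /val_inj.
Qed.
Let oP v : tnth D v -> exists k, v = o (s k).
Proof.
move=> Dv; have vf : v \in [seq v <- enum 'I_n.*2 | tnth D v] by rewrite mem_filter Dv mem_enum.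
have iv := vf; rewrite -index_mem sro in iv.
by exists ((s^-1)%g (Ordinal iv)); rewrite permKV /opener nth_index.
Qed.
Let cP v : ~~ tnth D v -> exists k, v = c k.
Proof.
move=> Dv; have vf : v \in [seq v <- enum 'I_n.*2 | ~~ tnth D v] by rewrite mem_filter Dv mem_enum.
have iv := vf; rewrite -index_mem sfa in iv.
by exists (Ordinal iv); rewrite /closer nth_index.
Qed.
Let oc i k : o i != c k.
Proof. by apply: contraTneq (oT i) => ->; apply: cF. Qed.
Let o_lt_c k : o (s k) < c k.
Proof.
have /forallP /(_ k) /eqP := proj2 (andP dF); rewrite risesE => rk.
apply: (@Order.PreorderTheory.nth_count_lt _ 'I_n.*2).
  apply: sorted_filter; first exact: Order.PreorderTheory.le_trans.
  by apply: sub_sorted (enum_ord_sorted _); exact: Order.PreorderTheory.ltW.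
have : s k < r k by move: sr; rewrite inE => /forallP.
by rewrite -rk.
Qed.

Let frP i k : ([set o (s i); c k] \in fr r s) = (i == k).
Proof.
apply/imsetP/eqP => [[j _ /setP e]|->]; last by exists k.
have := e (o (s i)); have := e (c k); rewrite !inE !eqxx orbT /=.
rewrite eq_sym (negPf (oc _ _)) (negPf (oc _ _)) orbF /= => /esym/eqP/c_inj <-.
by move/esym/eqP/o_inj/perm_inj.
Qed.
Let block_partner v w : w != v -> ([set v; w] \in fr r s) ->
  exists k, (v = o (s k) /\ w = c k) \/ (v = c k /\ w = o (s k)).
Proof.
move=> wv /imsetP[k _ /setP e]; exists k; move: (e v) (e w); rewrite !inE !eqxx orbT /=.
by case/esym/orP => /eqP ev /esym/orP[] /eqP ew; auto; rewrite ev ew eqxx in wv.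
Qed.

Lemma partner_opener k : partner (fr r s) (o (s k)) = c k.
Proof.
rewrite /partner; case: pickP => [w /andP[wv /(block_partner wv)[j]]|/(_ (c k))] /=.
  case=> [[/o_inj/perm_inj -> -> //]|[/eqP]]; by rewrite (negPf (oc _ _)).
by rewrite frP eqxx eq_sym oc.
Qed.
Lemma partner_closer k : partner (fr r s) (c k) = o (s k).
Proof.
rewrite /partner; case: pickP => [w /andP[wv /(block_partner wv)[j]]|/(_ (o (s k)))] /=.
  case=> [[/eqP]|[/c_inj -> -> //]]; by rewrite eq_sym (negPf (oc _ _)).
by rewrite setUC frP eqxx oc.
Qed.

Lemma fr_matching : fr r s \in matchings_of_type D.
Proof.
rewrite inE; apply/andP; split; last first.
  apply/forallP => v; rewrite /is_opener; case: (boolP (tnth D v)) => Dv.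
    by have [k ->] := oP Dv; rewrite partner_opener o_lt_c.
  have [k ->] := cP Dv; rewrite partner_closer ltnNge ltnW ?o_lt_c //.
have block B : B \in fr r s -> exists k, B = [set o (s k); c k].
  by case/imsetP => k _ ->; exists k.
apply/andP; split; last first.
  by apply/forall_inP => B /block[k ->]; rewrite cards2 oc.
apply/and3P; split.
- apply/eqP/setP => v; rewrite inE; apply/bigcupP.
  case: (boolP (tnth D v)) => Dv.
    by have [k ->] := oP Dv; exists [set o (s k); c k]; rewrite ?frP // !inE eqxx.
  by have [k ->] := cP Dv; exists [set o (s k); c k]; rewrite ?frP // !inE eqxx orbT.
- apply/trivIsetP => _ _ /block[i ->] /block[j ->]; have [->|ij _] := eqVneq i j.
    by rewrite eqxx.
  rewrite -setI_eq0; apply/eqP/setP => v; rewrite !inE.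
  apply/negP => /andP[/orP[]/eqP -> /orP[]].
  + by rewrite (inj_eq o_inj) (inj_eq perm_inj) (negPf ij).
  + by rewrite (negPf (oc _ _)).
  + by rewrite eq_sym (negPf (oc _ _)).
  + by rewrite (inj_eq c_inj) (negPf ij).
- by apply/negP => /block[k] /setP /(_ (c k)); rewrite !inE eqxx orbT.
Qed.
End Matching.
End DyckFor.

(* Main.v *)
Require Import Defs.
From HB Require Import structures.
From mathcomp Require Import all_boot all_order all_fingroup all_algebra.
From mathcomp Require Import mpoly zify.

Set Implicit Arguments.
Unset Strict Implicit.
Unset Printing Implicit Defensive.

Import GRing.Theory.
Local Open Scope ring_scope.

(* Write M, M0 for the matchings of s, s0. Restoring opener k amounts to replacing
   s by s o (a b), where a and b are the positions of the value k in s and in s0.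
   This maps the permutations of S_r that agree with s0 on the values > k to those
   agreeing on the values >= k, and a fiber is parametrized by a, which ranges over
   the h_k positions j with k < r_j and s0(j) <= k. The choice a = b makes k a cycle
   minimum of s s0^-1 and has sor_k = 0; for a <> b the element k is inserted into
   the cycle of a smaller one, and sor_k, the size of a cyclic interval ending at b,
   takes each of the values 1, .., h_k - 1 once. Hence the product formula.
   For s0 = 1 the restoring transpositions are the sort factorization. Finally,
   (inv, rlminl) is read off the Lehmer code, which maps S_r injectively into the
   product of the intervals [0, h_k); this is onto because the formula already
   proved, at q = t = 1, gives the cardinality of S_r. *)

(** * Cycle minima when a cycle is cut *)

Section CycleMinima.
Variable n : nat.
Implicit Types (s : 'S_n) (i m : 'I_n).

(** A stable set containing [i] contains its whole cycle, so any stable set with minimum [i] is a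
    certificate. Unlike orbits, such sets are easy to adapt when [s] is modified. *)
Lemma CycP s i :
  reflect (exists C : {set 'I_n},
             [/\ i \in C, {in C, forall j : 'I_n, s j \in C}
               & {in C, forall j : 'I_n, (i <= j)%N}])
          (i \in Cyc s).
Proof.
rewrite inE; apply: (iffP exists_inP) => [[C /imsetP[x _ ->]]|[C [iC sC lC]]].
  case/andP=> ix /forall_inP lx; exists (porbit s x); split=> // j.
  by rewrite -!eq_porbit_mem => /eqP <-; rewrite eq_sym -[s j](permX s j 1) porbit_perm.
exists (porbit s i); first exact: imset_f.
rewrite porbit_id; apply/forall_inP => j /porbitP[e ->]; apply: lC.
by elim: e => [|e IH]; rewrite ?expg0 ?perm1 // expgSr permM; apply: sC.
Qed.

(** If [m] is the minimum of its cycle then [s m >= m], and a value [s m > m] would be fixed by [s],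
    against injectivity. *)
Lemma Cyc_max s m : (forall j : 'I_n, (m < j)%N -> s j = j) ->
  (m \in Cyc s) = (s m == m).
Proof.
move=> fs; apply/CycP/eqP => [[C [mC sC lC]]|sm]; last first.
  by exists [set m]; split=> [|j|j]; rewrite ?set11 // !inE => /eqP ->; rewrite ?sm.
apply: val_inj; have := lC _ (sC _ mC); case: (ltngtP m (s m)) => // l _.
by have := l; rewrite (perm_inj (fs _ l)) ltnn.
Qed.

(* Multiplying by the transposition cuts m out of its cycle; since i < m, this
   does not change whether i is the minimum of its own cycle. *)
Lemma Cyc_cut s m i : (i < m)%N ->
  (i \in Cyc (tperm ((s^-1)%g m) m * s)%g) = (i \in Cyc s).
Proof.
move=> im; set a := (s^-1)%g m; have sa : s a = m by rewrite permKV.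
have [am|am] := eqVneq a m; first by rewrite am tperm1 mul1g.
have sE j : (tperm a m * s)%g j = if j == a then s m else if j == m then m else s j.
  rewrite permM; case: tpermP => [->|->|/eqP/negPf -> /eqP/negPf -> //].
    by rewrite eqxx.
  by rewrite eq_sym (negPf am) eqxx.
have sm j : j != a -> s j != m by rewrite -sa (inj_eq perm_inj).
apply/CycP/CycP => -[C [iC sC lC]].
  have [aC|aC] := boolP (a \in C).
    exists (m |: C); split=> [|j|j]; rewrite ?inE ?iC ?orbT //.
      have smC : s m \in C by have := sC _ aC; rewrite sE eqxx.
      case/orP=> [/eqP ->|jC]; first by rewrite smC orbT.
      have := sC _ jC; rewrite sE; case: eqP => [-> _|_]; first by rewrite sa eqxx.
      by case: eqP => [-> _|_ ->]; rewrite ?smC orbT.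
    by case/orP=> [/eqP ->|/lC //]; apply: ltnW.
  exists (C :\ m); split=> [|j|j]; rewrite ?inE.
  - by rewrite iC andbT; apply: contraTneq im => ->; rewrite ltnn.
  - case/andP=> jm jC; have ja : j != a by apply: contraNneq aC => <-.
    by rewrite sm //; have := sC _ jC; rewrite sE (negPf ja) (negPf jm).
  - by case/andP=> _ /lC.
exists (C :\ m); split=> [|j|j]; rewrite ?inE.
- by rewrite iC andbT; apply: contraTneq im => ->; rewrite ltnn.
- case/andP=> jm jC; rewrite sE (negPf jm); have [ja|ja] := eqVneq j a.
    by rewrite sm ?sC // 1?eq_sym // -sa -ja sC.
  by rewrite sm // sC.
- by case/andP=> _ /lC.
Qed.

End CycleMinima.

(** * Openers, closers and heights on the path [D(r)] *)

Section DyckVertices.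
Variables (n : nat) (r : 'I_n -> nat).
Hypothesis r_le : forall k, (r k <= n)%N.
Hypothesis r_mono : forall i j : 'I_n, (i <= j)%N -> (r i <= r j)%N.
Hypothesis r_ge : forall k : 'I_n, (k < r k)%N.
Local Notation D := (dyck_of r).
Local Notation o := (opener D).
Local Notation c := (closer D).

Let dF : dyck_for r D. Proof. by rewrite dyck_ofP. Qed.
Let sro := dyck_size_rises (proj1 (andP dF)).
Let sfa := dyck_size_falls (proj1 (andP dF)).

Lemma tnth_opener i : tnth D (o i).
Proof.
have : o i \in [seq v <- enum 'I_n.*2 | tnth D v] by rewrite mem_nth ?sro.
by rewrite mem_filter => /andP[].
Qed.

Lemma tnth_closer i : tnth D (c i) = false.
Proof.
have : c i \in [seq v <- enum 'I_n.*2 | ~~ tnth D v] by rewrite mem_nth ?sfa.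
by rewrite mem_filter => /andP[/negbTE].
Qed.

Lemma opener_neq_closer i j : (o i == c j) = false.
Proof. by apply: contraTF (tnth_opener i) => /eqP ->; rewrite tnth_closer. Qed.

Lemma vertex_cases v : (exists i, v = o i) \/ (exists i, v = c i).
Proof.
case: (boolP (tnth D v)) => Dv; [left|right].
  have vf : v \in [seq v <- enum 'I_n.*2 | tnth D v] by rewrite mem_filter Dv mem_enum.
  have iv := vf; rewrite -index_mem sro in iv.
  by exists (Ordinal iv); rewrite /opener nth_index.
have vf : v \in [seq v <- enum 'I_n.*2 | ~~ tnth D v] by rewrite mem_filter Dv mem_enum.
have iv := vf; rewrite -index_mem sfa in iv.
by exists (Ordinal iv); rewrite /closer nth_index.
Qed.

Lemma rises_opener i : rises D (o i) = i.
Proof.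
rewrite risesE; apply: (@Order.PreorderTheory.count_lt_nth _ 'I_n.*2); last by rewrite sro.
by apply: sorted_filter (enum_ord_sorted _); exact: Order.POrderTheory.lt_trans.
Qed.

Lemma falls_closer i : falls D (c i) = i.
Proof. by rewrite /closer nth_falls // sfa. Qed.

Lemma rises_closer i : rises D (c i) = r i.
Proof. by have /andP[_ /forallP /(_ i) /eqP] := dF. Qed.

Lemma opener_inj : injective o.
Proof. by move=> i j e; apply: val_inj; rewrite /= -rises_opener e rises_opener. Qed.

Lemma closer_inj : injective c.
Proof. by move=> i j e; apply: val_inj; rewrite /= -falls_closer e falls_closer. Qed.

Lemma risesS (v : 'I_n.*2) : rises D v.+1 = (rises D v + tnth D v)%N.
Proof.
rewrite /rises (take_nth true) ?size_tuple // -cats1 count_cat /= addn0.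
by rewrite (tnth_nth true).
Qed.

Lemma fallsS (v : 'I_n.*2) : falls D v.+1 = (falls D v + ~~ tnth D v)%N.
Proof.
rewrite /falls (take_nth true) ?size_tuple // -cats1 count_cat /= addn0.
by rewrite (tnth_nth true).
Qed.

Lemma leq_rises m m' : (m <= m')%N -> (rises D m <= rises D m')%N.
Proof. by move=> mm; rewrite /rises -(subnKC mm) takeD count_cat leq_addr. Qed.

Lemma leq_falls m m' : (m <= m')%N -> (falls D m <= falls D m')%N.
Proof. by move=> mm; rewrite /falls -(subnKC mm) takeD count_cat leq_addr. Qed.

Lemma opener_lt_closer i j : (o i < c j)%N = (i < r j)%N.
Proof.
case: (ltngtP (o i) (c j)) => [l|l|e].
- by have := leq_rises l; rewrite risesS rises_opener tnth_opener rises_closer addn1.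
- by have := leq_rises (ltnW l); rewrite rises_opener rises_closer ltnNge => ->.
- by have := opener_neq_closer i j; rewrite (val_inj e) eqxx.
Qed.

Lemma opener_lt i j : (o i < o j)%N = (i < j)%N.
Proof.
case: (ltngtP (o i) (o j)) => [l|l|e].
- by have := leq_rises l; rewrite risesS !rises_opener tnth_opener addn1.
- by have := leq_rises l; rewrite risesS !rises_opener tnth_opener addn1 => /ltnW; rewrite ltnNge => ->.
- by rewrite (opener_inj (val_inj e)) ltnn.
Qed.

Lemma closer_lt i j : (c i < c j)%N = (i < j)%N.
Proof.
case: (ltngtP (c i) (c j)) => [l|l|e].
- by have := leq_falls l; rewrite fallsS !falls_closer tnth_closer addn1.
- by have := leq_falls l; rewrite fallsS !falls_closer tnth_closer addn1 => /ltnW; rewrite ltnNge => ->.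
- by rewrite (closer_inj (val_inj e)) ltnn.
Qed.

Lemma closer_le i j : (c i <= c j)%N = (i <= j)%N.
Proof. by rewrite leqNgt closer_lt -leqNgt. Qed.

(** The falls before [o i] are the closers [c j] with [r j <= i], by [opener_lt_closer]. *)
Lemma height_explicit i : height D i = (i.+1 - #|[set j | (r j <= i)%N]|)%N.
Proof.
rewrite /height risesS fallsS rises_opener tnth_opener addn1 addn0; congr (_ - _)%N.
have cE : [seq v <- enum 'I_n.*2 | ~~ tnth D v] = map c (enum 'I_n).
  apply: (@eq_from_nth _ (o i)) => [|j]; first by rewrite sfa size_map size_enum_ord.
  rewrite sfa => jn; rewrite (nth_map (Ordinal jn)) ?size_enum_ord //.
  rewrite (_ : nth _ _ _ = Ordinal jn); last by apply: val_inj; rewrite /= nth_enum_ord.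
  by rewrite /closer (set_nth_default (o i)) ?sfa.
rewrite fallsE cE count_map -sum1_count -sum1_card big_enum_cond.
apply: eq_bigl => j; rewrite !inE /=.
rewrite [RHS]leqNgt -opener_lt_closer -leqNgt [RHS]leq_eqVlt.
by case: eqP => //= e; have := opener_neq_closer i j; rewrite (val_inj e) eqxx.
Qed.

(** Since [s j < r j], every [j] with [r j <= i] is among the [i] positions whose value is below
    [i]; removing them leaves [height D i - 1], whatever [s] is. *)
Lemma card_inner (s : 'S_n) (i : 'I_n) : s \in Sr r ->
  #|[set j | (i < r j)%N && (s j < i)%N]|.+1 = height D i.
Proof.
rewrite inE => /forallP sr; rewrite height_explicit.
have -> : #|[set j | (r j <= i)%N]| = #|[set j | (s j < i)%N] :\: [set j | (i < r j)%N && (s j < i)%N]|.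
  apply: eq_card => j; rewrite !inE; have := sr j; lia.
have cs : #|[set j | (s j < i)%N]| = i.
  rewrite -[RHS](minn_idPl (ltnW (ltn_ord i))) -card_ord_lt -(card_imset _ (@perm_inj _ s)).
  apply: eq_card => j; rewrite !inE; apply/imsetP/idP => [[x + ->]|ji]; first by rewrite inE.
  by exists ((s^-1)%g j); rewrite ?inE permKV.
have := cardsID [set j | (i < r j)%N && (s j < i)%N] [set j | (s j < i)%N].
rewrite cs (setIidPr _); last by apply/subsetP => j; rewrite !inE => /andP[].
by move=> e; rewrite -[X in (X.+1 - _)%N]e -addSn addnK.
Qed.

End DyckVertices.

(** * Partially sorted permutations *)

Section Sorting.
Variables (n : nat) (r : 'I_n -> nat) (s0 : 'S_n).
Hypothesis r_le : forall k, (r k <= n)%N.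
Hypothesis r_mono : forall i j : 'I_n, (i <= j)%N -> (r i <= r j)%N.
Hypothesis r_ge : forall k : 'I_n, (k < r k)%N.
Hypothesis s0_Sr : s0 \in Sr r.
Implicit Types (s : 'S_n) (k a j : 'I_n) (m : nat).

Local Notation D := (dyck_of r).
Local Notation o := (opener D).
Local Notation c := (closer D).
Local Notation M0 := (fr r s0).

(** The permutations that can occur as the stage [M_m] of sorting towards [s0]: all of [Sr r] for
    [m = n], only [s0] for [m = 0]. *)
Definition sorted_from m : {set 'S_n} :=
  [set s in Sr r | [forall j, (m <= s0 j)%N ==> (s j == s0 j)]].

Definition restore s k : 'S_n := (tperm ((s^-1)%g k) ((s0^-1)%g k) * s)%g.

Definition admissible k : {set 'I_n} := [set j | (k < r j)%N && (s0 j <= k)%N].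

(** The indices of the closers eligible in [sor_k]: those after [o_k] that [M0] joins to an opener
    before [o_k]. *)
Definition inner k : {set 'I_n} := [set j | (k < r j)%N && (s0 j < k)%N].

(* The cyclic interval of inner k running from a up to the position of k in s0. *)
Definition cyclic_interval k a : {set 'I_n} :=
  [set j in inner k | if (a <= (s0^-1)%g k)%N then (a <= j <= (s0^-1)%g k)%N
                      else ~~ ((s0^-1)%g k < j < a)%N].

Lemma sorted_fromP m s :
  reflect (s \in Sr r /\ forall j, (m <= s0 j)%N -> s j = s0 j)
          (s \in sorted_from m).
Proof.
rewrite [X in reflect _ X]inE; apply: (iffP andP) => -[sr H]; split=> //.
  by move=> j mj; move/forallP/(_ j)/implyP/(_ mj)/eqP: H.
by apply/forallP => j; apply/implyP => /H/eqP.
Qed.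

Lemma sorted_from_Sr m s : s \in sorted_from m -> s \in Sr r.
Proof. by case/sorted_fromP. Qed.

Lemma sorted_from_eq m s j : s \in sorted_from m -> (m <= s j)%N -> s0 j = s j.
Proof.
case/sorted_fromP => _ H mj; have := H ((s0^-1)%g (s j)); rewrite permKV => /(_ mj).
by move/perm_inj => e; rewrite -{1}e permKV.
Qed.

Lemma sorted_fromW m m' s : (m <= m')%N ->
  s \in sorted_from m -> s \in sorted_from m'.
Proof.
move=> mm' /sorted_fromP[sr H]; apply/sorted_fromP; split=> // j m'j.
exact/H/(leq_trans mm').
Qed.

Lemma sorted_from_le m s j : s \in sorted_from m -> (s0 j < m)%N -> (s j < m)%N.
Proof.
move=> sT; apply: contraLR; rewrite -!leqNgt => mj.
by rewrite (sorted_from_eq sT mj).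
Qed.

Lemma sorted_from_inv m s k : s \in sorted_from m -> (m <= k)%N ->
  (s^-1)%g k = (s0^-1)%g k.
Proof.
case/sorted_fromP => _ H mk; apply: (@perm_inj _ s).
by rewrite permKV H permKV.
Qed.

Lemma restore_id m s k : s \in sorted_from m -> (m <= k)%N -> restore s k = s.
Proof. by move=> sT mk; rewrite /restore (sorted_from_inv sT mk) tperm1 mul1g. Qed.

Lemma sorted_fromT s : (s \in sorted_from n) = (s \in Sr r).
Proof.
apply/idP/idP => [/sorted_from_Sr //|sr]; apply/sorted_fromP; split=> // j.
by rewrite leqNgt ltn_ord.
Qed.

Lemma sorted_from0 s : (s \in sorted_from 0) = (s == s0).
Proof.
apply/sorted_fromP/eqP => [[_ H]|->]; last by [].
by apply/permP => j; apply: H.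
Qed.

Lemma Sr_lt s j : s \in Sr r -> (s j < r j)%N.
Proof. by rewrite inE => /forallP. Qed.

Section Step.
Variable k : 'I_n.
Let b := (s0^-1)%g k.
Let s0b : s0 b = k. Proof. exact: permKV. Qed.

(** This undoes a restoration: [k] moves to [a], allowed by [k < r a], and [s a] moves to [b],
    allowed because [s a <= k < r b]. *)
Lemma swap_sorted_from s a : s \in sorted_from k -> a \in admissible k ->
  (tperm a b * s)%g \in sorted_from k.+1.
Proof.
move=> sT; rewrite inE => /andP[ra s0a]; have sb : s b = k.
  by case/sorted_fromP: sT => _ /(_ b); rewrite s0b; apply.
apply/sorted_fromP; split.
  rewrite inE; apply/forallP => j; rewrite permM.
  case: tpermP => [->|->|_ _]; rewrite ?sb ?(Sr_lt _ (sorted_from_Sr sT)) //.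
  apply: leq_ltn_trans (_ : k < _)%N; last by rewrite -s0b Sr_lt.
  by apply: (sorted_from_le (sorted_fromW (leqnSn k) sT)).
move=> j kj; rewrite permM tpermD; first by case/sorted_fromP: sT => _; apply; apply: ltnW.
  by apply: contraTneq kj => <-; rewrite -leqNgt.
by apply: contraTneq kj => <-; rewrite s0b ltnn.
Qed.

Variable s : 'S_n.
Hypothesis sT : s \in sorted_from k.+1.
Let a := (s^-1)%g k.
Let sa : s a = k. Proof. exact: permKV. Qed.

Lemma sorted_from_admissible : a \in admissible k.
Proof.
rewrite inE -{1}sa (Sr_lt _ (sorted_from_Sr sT)) /= leqNgt; apply/negP.
by case/sorted_fromP: sT => _ H l; have := l; rewrite -(H _ l) sa ltnn.
Qed.

Lemma restore_sorted_from : restore s k \in sorted_from k.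
Proof.
have := sorted_from_admissible; rewrite inE => /andP[ra s0a].
apply/sorted_fromP; rewrite /restore -/a -/b; split.
  rewrite inE; apply/forallP => j; rewrite permM.
  case: tpermP => [->|->|_ _]; last by rewrite (Sr_lt _ (sorted_from_Sr sT)).
    by apply: leq_trans ra; apply: (sorted_from_le sT); rewrite s0b.
  by rewrite sa -s0b Sr_lt.
move=> j; rewrite leq_eqVlt => /orP[/eqP kj|kj].
  have -> : j = b by apply: (@perm_inj _ s0); rewrite s0b; apply: val_inj.
  by rewrite permM tpermR sa s0b.
rewrite permM tpermD; first by case/sorted_fromP: sT => _; apply.
  by apply: contraTneq kj => <-; rewrite -leqNgt.
by apply: contraTneq kj => <-; rewrite s0b ltnn.
Qed.

End Step.

(** * Sorting steps and stages of matchings, read on permutations *)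

Lemma set2_fr i j i' j' : [set o i; c j] = [set o i'; c j'] -> i = i' /\ j = j'.
Proof.
move/setP => e; have := e (o i); have := e (c j); rewrite !inE !eqxx orbT /=.
rewrite eq_sym !opener_neq_closer //= orbF => /esym/eqP/closer_inj-> //.
by move=> /esym/eqP/opener_inj->.
Qed.

Lemma partner_fr_opener s i : s \in Sr r -> partner (fr r s) (o i) = c ((s^-1)%g i).
Proof. by move=> sr; rewrite -{1}[i](permKV s) partner_opener. Qed.

(** The exchanged arcs are those of the closers at positions [s^-1 k] and [s0^-1 k], so the step
    exchanges the entries of [s] there. *)
Lemma sort_step_fr s k : s \in sorted_from k.+1 ->
  sort_step D M0 (fr r s) k = fr r (restore s k).
Proof.
move=> sT; have sr := sorted_from_Sr sT.
rewrite /sort_step !partner_fr_opener // partner_closer //.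
rewrite (inj_eq (@closer_inj _ r _ _ _)) //.
have [ab|ab] := eqVneq; first by rewrite /restore ab tperm1 mul1g.
set a := (s^-1)%g k in ab *; set b := (s0^-1)%g k in ab *.
have sa : s a = k by exact: permKV.
have RE j : restore s k j = if j == a then s b else if j == b then k else s j.
  rewrite /restore permM; case: tpermP => [->|->|/eqP/negPf -> /eqP/negPf -> //].
    by rewrite eqxx.
  by rewrite eq_sym (negPf ab) eqxx.
apply/setP => X; rewrite !inE; apply/idP/imsetP.
  case/orP=> [/andP[]|/orP[]/eqP ->].
  - rewrite negb_or => /andP[Xa Xb] /imsetP[j _ eX]; exists j => //.
    rewrite RE; case: eqP => [ja|_]; first by rewrite eX ja sa eqxx in Xa.
    by case: eqP => [jb|//]; rewrite eX jb eqxx in Xb.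
  - by exists b; rewrite // RE eqxx eq_sym (negPf ab).
  - by exists a; rewrite // RE eqxx.
case=> j _ ->; have [->|ja] := eqVneq j a; first by rewrite RE !eqxx !orbT.
have [->|jb] := eqVneq j b; first by rewrite RE [b == a]eq_sym (negPf ab) !eqxx !orbT.
have jM : [set o (s j); c j] \in fr r s by apply/imsetP; exists j.
rewrite RE (negPf ja) (negPf jb) jM andbT negb_or.
apply/orP; left; apply/andP.
by split; [apply: contraNneq ja | apply: contraNneq jb] => /set2_fr[_ ->].
Qed.

Lemma foldl_sort_step_id s (L : seq 'I_n) m : s \in sorted_from m ->
  all (fun i : 'I_n => m <= i)%N L -> foldl (sort_step D M0) (fr r s) L = fr r s.
Proof.
move=> sT; elim: L => //= i L IH /andP[mi /IH {2}<-].
by rewrite sort_step_fr ?(restore_id sT mi) //; apply: sorted_fromW sT; apply: ltnW.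
Qed.

Lemma sort_stage_id s k m : s \in sorted_from m -> (m <= k.+1)%N ->
  sort_stage D M0 (fr r s) k = fr r s.
Proof.
move=> sT mk; apply: (foldl_sort_step_id sT).
by apply/allP => i; rewrite mem_filter => /andP[ki _]; apply: leq_trans mk ki.
Qed.

(** The steps above [k] fix both matchings, and step [k] sends both to the matching of
    [restore s k]; from there on the processes coincide. *)
Lemma sort_stage_restore s k (i : 'I_n) : s \in sorted_from k.+1 -> (i < k)%N ->
  sort_stage D M0 (fr r s) i = sort_stage D M0 (fr r (restore s k)) i.
Proof.
move=> sT ik; rewrite /sort_stage.
have kL : k \in [seq j : 'I_n <- rev (enum 'I_n) | (i < j)%N].
  by rewrite mem_filter ik mem_rev mem_enum.
have Ls : sorted (fun x y : 'I_n => y < x)%N [seq j : 'I_n <- rev (enum 'I_n) | (i < j)%N].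
  apply: sorted_filter; first by move=> y x z yx zy; apply: ltn_trans zy yx.
  rewrite rev_sorted; exact: enum_ord_sorted.
case/splitPr: kL Ls => L1 L2; rewrite sorted_pairwise; last by move=> y x z yx zy; apply: ltn_trans zy yx.
rewrite pairwise_cat => /and3P[/allrelP H _ _].
have H1 : all (fun j : 'I_n => k.+1 <= j)%N L1.
  by apply/allP => j jL; apply: H => //; rewrite inE eqxx.
rewrite !foldl_cat (foldl_sort_step_id sT H1) /= sort_step_fr //.
have rT := restore_sorted_from sT.
rewrite (foldl_sort_step_id (sorted_fromW (leqnSn k) rT) H1).
rewrite sort_step_fr ?(sorted_fromW (leqnSn k)) //.
by rewrite (restore_id rT).
Qed.

Lemma sor_at_fr s k : s \in sorted_from k.+1 ->
  sor_at D M0 (fr r s) k = #|cyclic_interval k ((s^-1)%g k)|.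
Proof.
move=> sT; have sr := sorted_from_Sr sT.
rewrite /sor_at (sort_stage_id sT) // !partner_fr_opener // closer_le //.
rewrite -(card_imset (cyclic_interval _ _) (@closer_inj _ r r_le r_mono r_ge)).
(* A counted vertex is a closer: an opener beyond [o k] has its partner in [M0] further right, never
   before [o k]. *)
have H (v : 'I_n.*2) : ((o k < v) && (partner M0 v < o k))%N -> exists2 j, v = c j & j \in inner k.
  have [[i ->]|[j ->]] := vertex_cases r_le r_mono r_ge v; last first.
    rewrite partner_closer // opener_lt_closer // opener_lt // => Hj.
    by exists j; rewrite // inE.
  rewrite partner_fr_opener // opener_lt // => /andP[ki].
  rewrite -(opener_lt r_le r_mono r_ge) in ki.
  have : (o i < c ((s0^-1)%g i))%N by rewrite opener_lt_closer // -{1}[i](permKV s0) Sr_lt.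
  by move: ki; lia.
have E j : [&& o k < c j & partner M0 (c j) < o k]%N = (j \in inner k).
  by rewrite partner_closer // opener_lt_closer // opener_lt // inE.
case: leqP => ab; apply: eq_card => v; rewrite inE.
  apply/and3P/imsetP => [[h1 h2 h3]|[j]].
    have [|j vE jk] := H v; first by rewrite h1.
    by exists j; rewrite // inE jk ab -!(closer_le r_le r_mono r_ge) -vE.
  by rewrite inE -E ab => /andP[/andP[h1 h3] h2] ->; rewrite !closer_le.
apply/and3P/imsetP => [[h1 h2 h3]|[j]].
  have [|j vE jk] := H v; first by rewrite h1.
  by exists j; rewrite // inE jk (ltn_geF ab) -!(closer_lt r_le r_mono r_ge) -vE.
by rewrite inE -E (ltn_geF ab) => /andP[/andP[h1 h3] h2] ->; rewrite !closer_lt.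
Qed.

Lemma cyclic_interval_self k : cyclic_interval k ((s0^-1)%g k) = set0.
Proof.
apply/setP => j; rewrite !inE leqnn; apply/negP => /andP[/andP[_ jk] /andP[h1 h2]].
have e : j = (s0^-1)%g k by apply: val_inj; apply/eqP; rewrite eqn_leq h1 h2.
by rewrite e permKV ltnn in jk.
Qed.

Lemma sor_at_sorted s k m : s \in sorted_from m -> (m <= k)%N ->
  sor_at D M0 (fr r s) k = 0%N.
Proof.
move=> sT mk; rewrite sor_at_fr; last by apply: sorted_fromW sT; apply: ltnW.
by rewrite (sorted_from_inv sT mk) cyclic_interval_self cards0.
Qed.

(** Only the term at [k] changes, becoming zero after the restoration: the terms above it vanish on
    both sides, and those below see the same stages. *)
Lemma sorM_restore s k : s \in sorted_from k.+1 ->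
  sorM D (fr r s) M0 = (#|cyclic_interval k ((s^-1)%g k)| + sorM D (fr r (restore s k)) M0)%N.
Proof.
move=> sT; have rT := restore_sorted_from sT.
rewrite /sorM (bigD1 k) //= sor_at_fr // [in RHS](bigD1 k) //= (sor_at_sorted rT) //.
congr addn; rewrite add0n; apply: eq_bigr => i ik.
case: (ltngtP i k) => [lt|gt|/val_inj e]; last by rewrite e eqxx in ik.
  by rewrite /sor_at (sort_stage_restore sT lt).
by rewrite (sor_at_sorted sT) // (sor_at_sorted rT) // ltnW.
Qed.

Lemma sorM_self : sorM D M0 M0 = 0%N.
Proof.
rewrite /sorM big1 // => k _; apply: (@sor_at_sorted _ _ 0) => //.
by rewrite sorted_from0.
Qed.

(** * Sizes of the cyclic intervals *)

Lemma card_cyclic_interval_inj k :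
  {in inner k &, injective (fun a => #|cyclic_interval k a|)}.
Proof.
pose b := (s0^-1)%g k.
(* In the cyclic order that starts just after [b] and ends at [b], moving the left end from [a] to a
   later [a'] shrinks the interval and loses [a]. *)
have lt a a' : a \in inner k -> a' \in inner k ->
    (a < a' <= b)%N || (b < a < a')%N || (a' <= b < a)%N ->
    (#|cyclic_interval k a'| < #|cyclic_interval k a|)%N.
  move=> ak a'k; rewrite -/b => aa'; apply: proper_card; apply/properP; split.
    apply/subsetP => j; rewrite !inE -/b => /andP[-> /=]; move: aa'; case: ifP; case: ifP; lia.
  exists a; rewrite in_set -/b ?ak ?andbF //=; first by case: ifP; lia.
  by move: aa'; case: ifP; lia.
move=> a a' ak a'k e; apply/eqP/negPn/negP => aa'.
have := lt _ _ ak a'k; have := lt _ _ a'k ak; rewrite e ltnn.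
have : nat_of_ord a != nat_of_ord a' by [].
by lia.
Qed.

(** The sizes are distinct and lie between 1 and [#|inner k| = height D k - 1], so each of these
    values occurs exactly once. *)
Lemma sum_cyclic_interval (V : nmodType) (F : nat -> V) k :
  \sum_(a in inner k) F #|cyclic_interval k a| = \sum_(1 <= j < height D k) F j.
Proof.
pose L := [seq #|cyclic_interval k a| | a <- enum (inner k)].
have -> : \sum_(a in inner k) F #|cyclic_interval k a| = \sum_(j <- L) F j.
  by rewrite big_map big_enum.
apply: perm_big; rewrite -(card_inner r_le r_mono r_ge k s0_Sr) -/(inner k).
have sL : size L = #|inner k| by rewrite size_map -cardE.
have uL : uniq L.
  rewrite map_inj_in_uniq ?enum_uniq // => a a'; rewrite !mem_enum.
  exact: card_cyclic_interval_inj.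
apply: uniq_perm; rewrite ?iota_uniq //.
have sub : {subset L <= index_iota 1 #|inner k|.+1}.
  move=> j /mapP[a]; rewrite mem_enum => ak ->; rewrite mem_index_iota ltnS.
  apply/andP; split; last by apply/subset_leq_card/subsetP => i; rewrite inE => /andP[].
  by rewrite card_gt0; apply/set0Pn; exists a; rewrite inE ak; case: ifP; lia.
by apply: (uniq_min_size uL sub _).2; rewrite size_iota subn1 sL.
Qed.

(** * The product formula for the sorting index and cycle minima *)

Section GeneratingFunction.
Variables (A : comNzRingType) (q : A) (t : 'I_n -> A).

Let choice_weight k a : A :=
  if a == (s0^-1)%g k then t k else q ^+ #|cyclic_interval k a|.

Lemma sum_choice_weight k :
  \sum_(a in admissible k) choice_weight k a
  = t k + \sum_(1 <= j < height D k) q ^+ j.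
Proof.
have s0b : s0 ((s0^-1)%g k) = k by exact: permKV.
rewrite (bigD1 ((s0^-1)%g k)) /=; last by rewrite inE s0b leqnn andbT -{1}s0b Sr_lt.
rewrite /choice_weight eqxx -sum_cyclic_interval; congr (_ + _).
rewrite [LHS](eq_bigr (fun a => q ^+ #|cyclic_interval k a|)); last first.
  by move=> a /andP[_ /negPf ->].
apply: eq_bigl => a; rewrite !inE [(s0 a < k)%N]ltn_neqAle -andbA; congr andb.
by rewrite andbC  -(inj_eq (@perm_inj _ s0)) s0b.
Qed.

(** Cycle minima [i >= m] are left out: on [sorted_from m] all such [i] are fixed points of
    [s s0^-1] and would only contribute a constant factor. *)
Let weight m s : A :=
  q ^+ sorM D (fr r s) M0
  * \prod_(i in Cyc (perm_comp s (s0^-1)%g) | (i < m)%N) t i.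

Lemma weight_restore s k : s \in sorted_from k.+1 ->
  weight k.+1 s = weight k (restore s k) * choice_weight k ((s^-1)%g k).
Proof.
move=> sT; pose p := perm_comp s (s0^-1)%g.
have pk : (p^-1)%g k = s0 ((s^-1)%g k) by rewrite /p /perm_comp invMg invgK permM.
(* Conjugation by [s0] turns the swap of positions into the transposition of [p^-1 k] and [k], which
   is the cut treated in [Cyc_cut]. *)
have pR : perm_comp (restore s k) (s0^-1)%g = (tperm ((p^-1)%g k) k * p)%g.
  by rewrite pk -[X in tperm _ X](permKV s0 k) -tpermJ /p /perm_comp /restore /conjg -!mulgA mulKVg.
have pfix (j : 'I_n) : (k < j)%N -> p j = j.
  move=> kj; rewrite /p /perm_comp permM.
  by case/sorted_fromP: sT => _ ->; rewrite permKV.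
have kC : (k \in Cyc p) = ((s^-1)%g k == (s0^-1)%g k).
  rewrite Cyc_max // -(inj_eq (@perm_inj _ (p^-1)%g)) permK pk eq_sym.
  by rewrite -[RHS](inj_eq (@perm_inj _ s0)) permKV.
have cut : \prod_(i in Cyc p | (i < k)%N) t i
    = \prod_(i in Cyc (perm_comp (restore s k) (s0^-1)%g) | (i < k)%N) t i.
  apply: eq_bigl => i; case ik: (i < k)%N; rewrite ?andbF // !andbT.
  by rewrite pR Cyc_cut.
rewrite /weight (sorM_restore sT) -/p /choice_weight exprD -kC -cut.
case: ifP => kp; last first.
  rewrite [_ * q ^+ _]mulrC [RHS]mulrAC; congr (_ * _).
  apply: eq_bigl => i; rewrite ltnS leq_eqVlt andb_orr.
  by case: eqP => [/val_inj ->|_]; rewrite ?kp ?andbF.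
rewrite kp in kC; rewrite (eqP (esym kC)) cyclic_interval_self cards0 expr0 mul1r -mulrA; congr (_ * _).
rewrite (bigD1 k) /=; last by rewrite kp ltnSn.
rewrite mulrC; congr (_ * _); apply: eq_bigl => i.
by rewrite -andbA; congr andb; rewrite ltnS ltn_neqAle andbC.
Qed.

Lemma sum_weight_step k :
  \sum_(s in sorted_from k.+1) weight k.+1 s
  = (\sum_(s in sorted_from k) weight k s)
    * (t k + \sum_(1 <= j < height D k) q ^+ j).
Proof.
rewrite -sum_choice_weight big_distrlr pair_big /=.
(* [h] rebuilds a permutation from its restoration and the former position of [k], the data that
   [h'] extracts. *)
pose h (u : 'S_n * 'I_n) : 'S_n := (tperm u.2 ((s0^-1)%g k) * u.1)%g.
pose h' s := (restore s k, (s^-1)%g k).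
have h'K s : h (h' s) = s by rewrite /h /= mulgA tperm2 mul1g.
rewrite (reindex_onto h h') => [|s _]; last exact: h'K.
apply: eq_big => [[s a]|[s a]] /=; last first.
  by case/andP=> hT /eqP[E1 E2]; rewrite weight_restore // E1 E2.
apply/andP/andP => [[hT /eqP[E1 E2]]|[sT ak]].
  by split; [rewrite -E1; exact: restore_sorted_from
            | rewrite -E2; exact: sorted_from_admissible].
split; first exact: swap_sorted_from.
have ha : ((h (s, a))^-1)%g k = a.
  apply: (@perm_inj _ (h (s, a))); rewrite permKV /h /= permM tpermL.
  by case/sorted_fromP: sT => _ ->; rewrite permKV.
by rewrite /h' ha /restore ha /h /= mulgA tperm2 mul1g.
Qed.

Lemma sum_sorM :
  \sum_(s in Sr r) q ^+ sorM D (fr r s) M0 * \prod_(i in Cyc (perm_comp s (s0^-1)%g)) t i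
  = \prod_(i < n) (t i + \sum_(1 <= j < height D i) q ^+ j).
Proof.
have H m : (m <= n)%N -> \sum_(s in sorted_from m) weight m s
    = \prod_(i < n | (i < m)%N) (t i + \sum_(1 <= j < height D i) q ^+ j).
  elim: m => [|m IH] mn.
    rewrite (big_pred1 s0) => [|s]; last by rewrite sorted_from0.
    rewrite /weight sorM_self expr0 mul1r !big1 // => i; last by rewrite andbF.
  rewrite (sum_weight_step (Ordinal mn)) IH ?(ltnW mn) //.
  rewrite [RHS](bigD1 (Ordinal mn)) /= ?ltnSn // mulrC; congr (_ * _).
  by apply: eq_bigl => i; rewrite ltnS ltn_neqAle andbC.
have := H n (leqnn n); rewrite [RHS](eq_bigl xpredT) => [<-|i]; last exact: ltn_ord.
apply: eq_big => s; first by rewrite sorted_fromT.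
by move=> _; rewrite /weight; congr (_ * _); apply: eq_bigl => i; rewrite ltn_ord andbT.
Qed.

End GeneratingFunction.

End Sorting.

(** * The Lehmer code, indexed by values *)

Section LehmerCode.
Variable n : nat.
Implicit Types (s u : 'S_n) (k j : 'I_n).

Definition later_smaller s k : {set 'I_n} :=
  [set j : 'I_n | ((s^-1)%g k < j)%N && (s j < k)%N].

(** Entries are at most [n], so [inord] keeps them; the finite codomain lets codes range over a
    [family]. *)
Definition lehmer s : {ffun 'I_n -> 'I_n.+1} :=
  [ffun k => inord #|later_smaller s k|].

Lemma lehmerE s k : lehmer s k = #|later_smaller s k| :> nat.
Proof.
by rewrite ffunE inordK // ltnS; apply: leq_trans (max_card _) _; rewrite card_ord.
Qed.

(** The values above [k] occupy the same positions in [s] and [u]. From its earlier place [k] counts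
    every position counted from the later one, and also that later place itself. *)
Lemma card_later_smaller_lt s u k :
    (forall i : 'I_n, (k < i)%N -> (s^-1)%g i = (u^-1)%g i) ->
    ((s^-1)%g k < (u^-1)%g k)%N ->
  (#|later_smaller u k| < #|later_smaller s k|)%N.
Proof.
move=> eq_su lt_k.
have le_su j : (u j <= k)%N -> (s j <= k)%N.
  apply: contraLR; rewrite -!ltnNge => kj; have := eq_su _ kj.
  by rewrite permK => /(congr1 u); rewrite permKV => ->.
have lt_s j : ((s^-1)%g k < j)%N -> (s j <= k)%N -> (s j < k)%N.
  rewrite [(s j <= k)%N]leq_eqVlt => kj /orP[/eqP/val_inj e|//].
  by rewrite -e permK ltnn in kj.
apply/proper_card/properP; split.
  apply/subsetP => j; rewrite !inE => /andP[kj /ltnW/le_su].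
  have kj' : ((s^-1)%g k < j)%N by apply: ltn_trans kj.
  by rewrite kj' => /lt_s ->.
by exists ((u^-1)%g k); rewrite !inE ?ltnn // lt_k lt_s // le_su // permKV.
Qed.

Lemma lehmer_inj : injective lehmer.
Proof.
move=> s u /ffunP e; apply: invg_inj; apply/permP => i; apply/eqP/negPn/negP => di.
case: (@arg_maxnP _ i (fun k => (s^-1)%g k != (u^-1)%g k) val di) => k dk maxk.
have eq_su (j : 'I_n) : (k < j)%N -> (s^-1)%g j = (u^-1)%g j.
  by apply: contraTeq => /maxk /=; rewrite -leqNgt.
have ek : #|later_smaller s k| = #|later_smaller u k| by rewrite -!lehmerE e.
case: (ltngtP ((s^-1)%g k) ((u^-1)%g k)) => [lt|lt|/val_inj eqk].
- by have := card_later_smaller_lt eq_su lt; rewrite ek ltnn.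
- by have := card_later_smaller_lt (fun j kj => esym (eq_su j kj)) lt; rewrite ek ltnn.
- by rewrite eqk eqxx in dk.
Qed.

Lemma invs_lehmer s : invs s = (\sum_k lehmer s k)%N.
Proof.
rewrite /invs -sum1_card (reindex_inj (@perm_inj _ s)) /=.
rewrite [RHS](eq_bigr (fun i => \sum_(j in later_smaller s (s i)) 1)%N); last first.
  by move=> i _; rewrite lehmerE sum1_card.
rewrite pair_big_dep /=; apply: eq_bigl => -[i j]; rewrite !inE /= permK.
by [].
Qed.

Lemma rlminl_lehmer s : rlminl s = #|[set k | lehmer s k == 0%N :> nat]|.
Proof.
rewrite /rlminl; apply: eq_card => k; rewrite inE lehmerE cards_eq0.
apply/imsetP/eqP => [[i + ->]|e].
  rewrite inE => /forallP H; apply/setP => j; rewrite !inE permK.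
  by have := H j; case: (i < j)%N => //= ij; rewrite ltnNge ltnW.
exists ((s^-1)%g k); rewrite ?permKV // inE; apply/forallP => j; apply/implyP => kj.
rewrite permKV; move/setP/(_ j): e; rewrite !inE kj /= ltnNge => /negbFE.
rewrite leq_eqVlt => /orP[/eqP/val_inj jk|//].
by rewrite jk permK ltnn in kj.
Qed.

End LehmerCode.

(** * The case of the identity and the comparison with [(inv, rlminl)] *)

Section AtIdentity.
Variables (n : nat) (r : 'I_n -> nat).
Hypothesis r_le : forall k, (r k <= n)%N.
Hypothesis r_mono : forall i j : 'I_n, (i <= j)%N -> (r i <= r j)%N.
Hypothesis r_ge : forall k : 'I_n, (k < r k)%N.
Local Notation D := (dyck_of r).
Implicit Types (s : 'S_n) (k a j : 'I_n).

Lemma Sr1 : 1%g \in Sr r.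
Proof. by rewrite inE; apply/forallP => k; rewrite perm1. Qed.

(** For [s0 = 1] the interval consists of the [j] with [a <= j < k], as [k < r j] follows from
    [k < r a] by monotonicity. Its size is what the factor [(a k)] adds to [sor]. *)
Lemma card_cyclic_interval1 k a : (k < r a)%N -> (a <= k)%N ->
  #|cyclic_interval r 1 k a| = (k - a)%N.
Proof.
move=> kra ak; have lt (i : 'I_n) : #|[set j : 'I_n | (j < i)%N]| = i.
  by rewrite cardsE card_ord_lt; apply/minn_idPl/ltnW.
rewrite -[X in (X - _)%N]lt -[X in (_ - X)%N]lt -cardsDS; last first.
  by apply/subsetP => j; rewrite !inE => ja; apply: leq_trans ja ak.
apply: eq_card => j; rewrite !inE invg1 !perm1 ak -leqNgt.
case: (leqP a j) => [aj|]; rewrite ?andbF //=.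
by rewrite (leq_trans kra (r_mono aj)) /=; case: (ltngtP j k).
Qed.

(* Restoring k when M0 comes from the identity strips the last factor of the
   sort factorization. *)
Lemma sorM1_factorization m s : (m <= n)%N -> s \in sorted_from r 1 m ->
  exists w, [/\ sort_factorization s w, all (fun p : 'I_n * 'I_n => p.2 < m)%N w
    & (\sum_(p <- w) (p.2 - p.1) = sorM D (fr r s) (fr r 1%g))%N].
Proof.
elim: m s => [|m IH] s mn.
  rewrite (sorted_from0 Sr1) => /eqP ->; exists [::]; split=> //.
    by rewrite /sort_factorization big_nil /=.
  by rewrite big_nil sorM_self //; exact: Sr1.
move=> sT; pose k := Ordinal mn; have rT := restore_sorted_from Sr1 (k := k) sT.
have [w [Fw wm sw]] := IH _ (ltnW mn) rT.
have := sorM_restore r_le r_mono r_ge Sr1 (k := k) sT.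
have := sorted_from_admissible (k := k) sT; rewrite inE perm1 => /andP[kra ak].
rewrite card_cyclic_interval1 // -sw => ->.
have wm' : all (fun p : 'I_n * 'I_n => p.2 < m.+1)%N w.
  by apply: sub_all wm => p; apply: ltnW.
have [e|ne] := eqVneq ((s^-1)%g k) k.
  exists w; split=> //; last by rewrite e subnn.
  by rewrite /restore invg1 perm1 e tperm1 mul1g in Fw.
exists (rcons w ((s^-1)%g k, k)); split; last by rewrite big_rcons addnC.
  rewrite factorization_rcons /= wm ltn_neqAle ak andbT; apply/andP; split=> //.
  by rewrite /restore invg1 perm1 in Fw.
by rewrite all_rcons /= ltnSn.
Qed.

Lemma sor_sorM s : s \in Sr r -> sor s = sorM D (fr r s) (fr r 1%g).
Proof.
rewrite -(sorted_fromT r 1%g) => sT; have [w [Fw _ <-]] := sorM1_factorization (leqnn n) sT.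
exact: sorP.
Qed.

Lemma sum_sor (A : comNzRingType) (q : A) (t : 'I_n -> A) :
  \sum_(s in Sr r) q ^+ sor s * \prod_(i in Cyc s) t i
  = \prod_(i < n) (t i + \sum_(1 <= j < height D i) q ^+ j).
Proof.
rewrite -(sum_sorM r_le r_mono r_ge Sr1); apply: eq_bigr => s sr.
by rewrite sor_sorM // /perm_comp invg1 mul1g.
Qed.

Lemma height_gt0 k : (0 < height D k)%N.
Proof. by rewrite -(card_inner r_le r_mono r_ge k Sr1). Qed.

Lemma height_le k : (height D k <= n)%N.
Proof.
rewrite height_explicit //; apply: leq_trans (leq_subr _ _) _; exact: ltn_ord.
Qed.

Lemma card_Sr : #|Sr r| = (\prod_(k < n) height D k)%N.
Proof.
apply/eqP; rewrite -(Num.Theory.eqr_nat int) natr_prod; apply/eqP.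
rewrite -sumr_const.
(* This is [sum_sor] at [q = t = 1], where each factor becomes [1 + (height - 1)]. *)
rewrite (eq_bigr (fun s => 1 ^+ sor s * \prod_(i in Cyc s) (1 : int))); last first.
  by move=> s _; rewrite expr1n big1 // mulr1.
rewrite (sum_sor 1 (fun=> 1)); apply: eq_bigr => k _.
under eq_bigr do rewrite expr1n.
by rewrite sumr_const_nat -mulrS subn1 prednK // height_gt0.
Qed.

(** The entry at [k] counts positions [j] after that of [k], where [k < r j] by monotonicity, so
    [card_inner] bounds it by [height D k - 1]. Equality follows by comparing cardinalities through
    [card_Sr]. *)
Lemma lehmer_Sr :
  [set lehmer s | s in Sr r] = [set f in family (fun k => [pred c : 'I_n.+1 | c < height D k]%N)].
Proof.
apply/eqP; rewrite eqEcard card_imset; last exact: lehmer_inj.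
rewrite cardsE card_family card_Sr; apply/andP; split; last first.
  rewrite foldrE big_map big_enum /=; apply: leq_prod => k _.
  rewrite card_ord_lt; exact: geq_minl.
apply/subsetP => _ /imsetP[s sr ->]; rewrite inE; apply/familyP => k.
rewrite inE lehmerE -(card_inner r_le r_mono r_ge k sr) ltnS.
apply/subset_leq_card/subsetP => j; rewrite !inE => /andP[kj ->]; rewrite andbT.
by apply: leq_trans (r_mono (ltnW kj)); rewrite -{1}[k](permKV s) Sr_lt.
Qed.

Lemma sum_invs (A : comNzRingType) (q t : A) :
  \sum_(s in Sr r) q ^+ invs s * t ^+ rlminl s
  = \prod_(i < n) (t + \sum_(1 <= j < height D i) q ^+ j).
Proof.
(* A zero entry marks a right-to-left minimum and gets [t]; an entry [c > 0] gets [q ^+ c]. *)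
pose w (c : 'I_n.+1) : A := q ^+ c * (if c == 0%N :> nat then t else 1).
transitivity (\sum_(s in Sr r) \prod_k w (lehmer s k)).
  apply: eq_bigr => s _; rewrite big_split /= -expr_sum -invs_lehmer; congr (_ * _).
  rewrite -big_mkcond prodr_const rlminl_lehmer; congr (_ ^+ _).
  by apply: eq_card => k; rewrite inE.
rewrite -(big_imset (fun f : {ffun 'I_n -> 'I_n.+1} => \prod_k w (f k))) /=; last first.
  by move=> s u _ _; apply: lehmer_inj.
rewrite lehmer_Sr; under eq_bigl do rewrite inE.
rewrite -(bigA_distr_big_dep (fun k => [pred c : 'I_n.+1 | c < height D k]%N) (fun _ c => w c)).
apply: eq_bigr => k _.
rewrite -(big_ord_widen_cond n.+1 xpredT (fun c => q ^+ c * (if c == 0%N then t else 1))).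
  rewrite -(big_mkord xpredT (fun c => q ^+ c * (if c == 0%N then t else 1))).
  rewrite big_ltn ?height_gt0 //= mul1r; congr (_ + _).
  by apply: eq_big_nat => c /andP[c0 _]; rewrite eqn0Ngt c0 mulr1.
exact: leqW (height_le k).
Qed.

End AtIdentity.

Theorem corollary2p11 (n : nat) (r : 'I_n -> nat)
    (r_range : forall k : 'I_n, (1 <= r k <= n)%N)
    (r_mono : forall i j : 'I_n, (i <= j)%N -> (r i <= r j)%N)
    (r_ge : forall k : 'I_n, (k.+1 <= r k)%N)
    (s0 : 'S_n) (s0_Sr : s0 \in Sr r) :
  let q := var_q n in
  let t := var_t n in
  let t_ := @var_ti n in
  let h := height (dyck_of r) in
  [/\ \sum_(s in Sr r)
         q ^+ sor_r r s s0 * \prod_(i in Cyc (perm_comp s s0^-1%g)) t_ i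
      = \prod_(i < n) (t_ i + \sum_(1 <= j < h i) q ^+ j),
      \sum_(s in Sr r) q ^+ sor s * \prod_(i in Cyc s) t_ i
      = \prod_(k < n) (t_ k + \sum_(1 <= j < h k) q ^+ j)
    & \sum_(s in Sr r) q ^+ sor s * t ^+ cyc s
      = \sum_(s in Sr r) q ^+ invs s * t ^+ rlminl s].
Proof.
move=> q t t_ h; have r_le k : (r k <= n)%N by case/andP: (r_range k).
split; first exact: sum_sorM.
  exact: sum_sor.
(* With every [t_i] set to [t], the product for [sor] is the one for [(inv, rlminl)]. *)
rewrite sum_invs // -(sum_sor r_le r_mono r_ge q (fun=> t)).
by apply: eq_bigr => s _; rewrite prodr_const.
Qed.
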